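(* Let $\varphi$ be an Orlicz function with complementary function $\varphi_*$. (i) Let $\mu$ be a non-atomic measure. If $d_{\varphi_*}<b_{\varphi_*}$ and $\varphi_*(b_{\varphi_*})\mu(\Omega)>1$, then $L_\varphi^0$ does not have the local diameter two property. (ii) Let $\mu$ be the counting measure on $\mathbb{N}$. If $d_{\varphi_*}<c_{\varphi_*}$ and $\varphi_*(c_{\varphi_*})=1$, then $\ell_\varphi^0$ does not have the local diameter two property.
   Context: All spaces are real; $(\Omega,\Sigma,\mu)$ is a complete $\sigma$-finite measure space. An Orlicz function is a convex, left-continuous function $\varphi:[0,\infty)\to[0,\infty]$ with $\varphi(0)=0$, not identically zero and not identically infinite on $(0,\infty)$. Its complementary function is $\varphi_*(u)=\sup_{v\ge0}\{uv-\varphi(v)\}$, again an Orlicz function. For an Orlicz function $\psi$ put $d_\psi=\sup\{u\ge0:\psi\text{ is linear on }[0,u]\}$ (i.e. $\psi(v)=kv$ on $[0,u]$ for some $k\in[0,\infty)$), $c_\psi=\sup\{u:\psi(u)\le1\}$, $b_\psi=\sup\{u:\psi(u)<\infty\}$; if $b_\psi=\infty$, $\psi(b_\psi)$ means $\lim_{u\to\infty}\psi(u)=\infty$. For measurable $f:\Omega\to\mathbb{R}$ (modulo a.e. equality) let $I_\varphi(f)=\int_\Omega\varphi(|f|)\,d\mu$. The Orlicz space is the set of $f$ with $I_\varphi(\lambda f)<\infty$ for some $\lambda>0$. Equipped with the Orlicz norm $\|f\|_\varphi^0=\sup\{\int_\Omega fg\,d\mu:I_{\varphi_*}(g)\le1\}=\inf_{k>0}\frac1k(1+I_\varphi(kf))$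 it is denoted $L_\varphi^0$ when $\mu$ is non-atomic and $\ell_\varphi^0$ when $\Omega=\mathbb{N}$ with counting measure. A Banach space $X$ has the local diameter two property if every slice $\{x\in B_X:x^*(x)>1-\epsilon\}$ ($x^*\in S_{X^*}$, $\epsilon>0$) of the closed unit ball $B_X$ has diameter two. *)

(* Defs.v *)
From HB Require Import structures.
From mathcomp Require Import all_boot all_order all_algebra.
From mathcomp Require Import generic_quotient ring_quotient.
From mathcomp Require Import all_classical all_reals all_analysis.
From mathcomp Require Import measurable_realfun lra.

Set Implicit Arguments.
Unset Strict Implicit.
Unset Printing Implicit Defensive.

Import Order.TTheory GRing.Theory Num.Theory.
Import numFieldNormedType.Exports.

Local Open Scope classical_set_scope.
Local Open Scope ring_scope.

(* Functions on [0, +oo[ are represented by total functions R -> \bar R whose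
   values at negative reals are never used. *)
Record orlicz_function (R : realType) (phi : R -> \bar R) : Prop := {
  orlicz_ge0 : forall u : R, 0 <= u -> (0 <= phi u)%E ;
  orlicz0 : phi 0 = 0%E ;
  orlicz_convex : forall u v t : R, 0 <= u -> 0 <= v -> 0 <= t -> t <= 1 ->
    (phi (t * u + (1 - t) * v)%R <= t%:E * phi u + (1 - t)%R%:E * phi v)%E ;
  orlicz_left_continuous : forall u : R, 0 < u -> phi v @[v --> u^'-] --> phi u ;
  orlicz_neq0 : exists2 u : R, 0 < u & phi u != 0%E ;
  orlicz_neqy : exists2 u : R, 0 < u & phi u != +oo%E
}.

Section orlicz_parameters.
Context (R : realType).
Implicit Types psi : R -> \bar R.
Local Open Scope ereal_scope.

Definition complementary psi (u : R) : \bar R :=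
  ereal_sup [set (u * v)%:E - psi v | v in [set v | (0 <= v)%R]].

Definition orlicz_d psi : \bar R :=
  ereal_sup [set u%:E | u in [set u | (0 <= u)%R /\
    exists2 k, (0 <= k)%R &
      forall v, (0 <= v)%R -> (v <= u)%R -> psi v = (k * v)%:E]].

Definition orlicz_c psi : \bar R :=
  ereal_sup [set u%:E | u in [set u | (0 <= u)%R /\ psi u <= 1]].

Definition orlicz_b psi : \bar R :=
  ereal_sup [set u%:E | u in [set u | (0 <= u)%R /\ psi u < +oo]].

Definition orlicz_at psi (u : \bar R) : \bar R :=
  if u is r%:E then psi r else lim (psi v @[v --> +oo%R]).

End orlicz_parameters.

Definition atom d (T : measurableType d) (R : realType)
    (mu : set T -> \bar R) (A : set T) :=
  [/\ measurable A, (0 < mu A)%E &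
    forall B, measurable B -> B `<=` A -> mu B = 0%E \/ mu (A `\` B) = 0%E].

Definition nonatomic d (T : measurableType d) (R : realType)
    (mu : set T -> \bar R) :=
  forall A, ~ atom mu A.

(* The library proves sigma_finite_counting, but [counting] is not inferred as
   a {sigma_finite_measure set nat -> \bar R} without this instance. *)
HB.instance Definition _ (R : realType) :=
  @Measure_isSigmaFinite.Build _ _ R (@counting nat R) (sigma_finite_counting R).

Section local_diameter_two_property.
Local Open Scope ereal_scope.

Definition unit_ball (R : realType) (X : normedModType R) : set X :=
  [set x | (`|x| <= 1)%R].
Arguments unit_ball {R} X.

Definition dual_norm (R : realType) (X : normedModType R)
    (f : {linear X -> R}) : \bar R :=
  ereal_sup [set `|f x|%:E | x in unit_ball X].

Definition dual_unit_sphere (R : realType) (X : normedModType R) :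
    set {linear X -> R} :=
  [set f : {linear X -> R} | continuous f /\ dual_norm f = 1].
Arguments dual_unit_sphere {R} X.

Definition slice (R : realType) (X : normedModType R)
    (f : {linear X -> R}) (e : R) : set X :=
  [set x | unit_ball X x /\ (f x > 1 - e)%R].

Definition diameter (R : realType) (X : normedModType R) (A : set X) : \bar R :=
  ereal_sup [set `|p.1 - p.2|%:E | p in A `*` A].

Definition local_diameter_two_property (R : realType) (X : normedModType R) :=
  forall (f : {linear X -> R}) (e : R), dual_unit_sphere X f -> (0 < e)%R ->
  diameter (slice f e) = 2%:E.

End local_diameter_two_property.

Section complementary_theory.
Context (R : realType) (phi : R -> \bar R) (hphi : orlicz_function phi).
Local Open Scope ereal_scope.
Local Notation psi := (complementary phi).

Lemma orlicz_homo u v : (0 <= u)%R -> (u <= v)%R -> phi u <= phi v.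
Proof.
move=> u0 uv; have v0 := le_trans u0 uv.
have [v00|vn0] := eqVneq v 0%R.
  have -> : u = v by apply/eqP; rewrite eq_le uv v00.
  by [].
have vp : (0 < v)%R by rewrite lt_neqAle eq_sym vn0.
have t0 : (0 <= u / v)%R by rewrite divr_ge0.
have t1 : (u / v <= 1)%R by rewrite ler_pdivrMr// mul1r.
have := orlicz_convex hphi v0 (lexx 0%R) t0 t1.
rewrite mulr0 addr0 divfK// (orlicz0 hphi) mule0 adde0 => /le_trans; apply.
rewrite -[leRHS]mul1e; apply: lee_wpmul2r; first exact: orlicz_ge0.
by rewrite lee_fin.
Qed.

Lemma complementary_ge0 u : 0 <= psi u.
Proof.
apply: ereal_sup_ubound; exists 0%R => //=.
by rewrite mulr0 (orlicz0 hphi) sube0.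
Qed.

Lemma complementary0 : psi 0%R = 0.
Proof.
apply/eqP; rewrite eq_le complementary_ge0 andbT.
apply: ge_ereal_sup => _ [v /= v0 <-].
by rewrite mul0r sub0e oppe_le0; exact: orlicz_ge0.
Qed.

Lemma complementary_homo u v : (u <= v)%R -> psi u <= psi v.
Proof.
move=> uv; apply: ge_ereal_sup => _ [w /= w0 <-].
apply: le_trans (ereal_sup_ubound _); last by exists w.
by apply: leeB => //; rewrite lee_fin ler_wpM2r.
Qed.

Lemma young u v : (0 <= v)%R -> (u * v)%:E <= phi v + psi u.
Proof.
move=> v0; have : (u * v)%:E - phi v <= psi u.
  by apply: ereal_sup_ubound; exists v.
have := orlicz_ge0 hphi v0; have := complementary_ge0 u.
case: (phi v) (psi u) => [r||] [s||] //=; rewrite ?leey//.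
by rewrite !lee_fin => _ _; rewrite lerBlDr addrC.
Qed.

Lemma complementary_small (M : R) : exists2 c : R,
  (0 < c)%R & psi c * M%:E <= 1.
Proof.
have [u0 u0p phiu0] := orlicz_neq0 hphi.
have phiu0p : 0 < phi u0 by rewrite lt_def phiu0 orlicz_ge0// ltW.
have [y yp yphi] : exists2 y : R, (0 < y)%R & y%:E <= phi u0.
  by case: (phi u0) phiu0p => [r|_|//]; [exists r|exists 1%R; rewrite ?leey].
pose a := (y / u0)%R.
have ap : (0 < a)%R by rewrite divr_gt0.
have lin v : (0 <= v)%R -> (a * v - y)%:E <= phi v.
  move=> v0; have [vu|uv] := leP v u0.
    apply: le_trans (orlicz_ge0 hphi v0); rewrite lee_fin subr_le0.
    by rewrite /a mulrAC ler_pdivrMr// ler_wpM2l// ltW.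
  have vp : (0 < v)%R by exact: lt_trans uv.
  have t0 : (0 <= u0 / v)%R by rewrite divr_ge0// ltW.
  have t1 : (u0 / v <= 1)%R by rewrite ler_pdivrMr// mul1r ltW.
  have := orlicz_convex hphi v0 (lexx 0%R) t0 t1.
  rewrite mulr0 addr0 divfK ?gt_eqF// (orlicz0 hphi) mule0 adde0.
  move=> /(le_trans yphi).
  have := orlicz_ge0 hphi v0; case: (phi v) => [r||]; rewrite ?leey//.
  rewrite !lee_fin => r0; rewrite mulrAC ler_pdivlMr// => yv.
  rewrite lerBlDr (@le_trans _ _ r)//; last by rewrite lerDl ltW.
  by rewrite /a mulrAC ler_pdivrMr// mulrC [(r * _)%R]mulrC mulrC.
pose t : R := (1 + y * `|M|)^-1%R.
have yM0 : (0 <= y * `|M|)%R by rewrite mulr_ge0// ltW.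
have den0 : (0 < 1 + y * `|M|)%R by rewrite ltr_pwDl.
have tp : (0 < t)%R by rewrite invr_gt0.
have t1 : (t <= 1)%R by rewrite invf_le1// lerDl.
exists (t * a)%R; first exact: mulr_gt0.
have psile : psi (t * a)%R <= (t * y)%:E.
  apply: ge_ereal_sup => _ [v /= v0 <-].
  have := lin _ v0; have := orlicz_ge0 hphi v0.
  case: (phi v) => [r||]//=; rewrite ?leNye// !lee_fin => r0 avr.
  have : (t * (a * v - y) <= r)%R.
    apply: (@le_trans _ _ (t * r)%R); first by rewrite ler_wpM2l// ltW.
    by rewrite ler_piMl.
  by rewrite mulrBr mulrA lerBlDr lerBlDl.
apply: (@le_trans _ _ (psi (t * a)%R * `|M|%:E)).
  by apply: lee_wpmul2l; [exact: complementary_ge0|rewrite lee_fin ler_norm].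
apply: (@le_trans _ _ ((t * y)%:E * `|M|%:E)).
  by apply: lee_wpmul2r; rewrite ?lee_fin.
by rewrite -EFinM lee_fin -mulrA /t mulrC ler_pdivrMr// mul1r lerDr.
Qed.

Lemma ge0_homo_measurable (h : R -> \bar R) :
  (forall u v, (0 <= u)%R -> (u <= v)%R -> h u <= h v) ->
  measurable_fun setT (fun x : R => h `|x|%R).
Proof.
move=> hh.
have -> : (fun x => h `|x|%R) =
    ((fun x => h (Num.max x 0%R)) : R -> \bar R) \o (fun x : R => `|x|%R).
  by apply/funext => x /=; rewrite max_l.
apply: measurableT_comp; last exact: normr_measurable.
apply: (measurability _ (ErealGenCInfty.measurableE R)) => //.
move=> _ [_ [y ->] <-]; rewrite setTI.
apply: is_interval_measurable => a b /= ha hb c /andP[ac cb].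
move: ha; rewrite !in_itv/= !andbT => /le_trans; apply; apply: hh.
  by rewrite le_max lexx orbT.
by rewrite ge_max le_max ac/= le_max lexx orbT.
Qed.
End complementary_theory.

Section orlicz_space.
Context d (T : measurableType d) (R : realType).
Variable mu : {sigma_finite_measure set T -> \bar R}.
Local Open Scope ereal_scope.

Definition modular (psi : R -> \bar R) (f : T -> R) : \bar R :=
  \int[mu]_x psi `|f x|%R.

Definition in_orlicz (phi : R -> \bar R) (f : T -> R) :=
  exists2 l : R, (0 < l)%R & modular phi (fun x => l * f x)%R < +oo.

Definition orlicz_norm (phi : R -> \bar R) (f : T -> R) : \bar R :=
  ereal_sup [set \int[mu]_x (f x * g x)%:E |
    g in [set g : {mfun T >-> R} | modular (complementary phi) g <= 1]].

Context (phi : R -> \bar R) (hphi : orlicz_function phi).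
Local Notation psi := (complementary phi).
Implicit Types f g : T -> R.

Lemma measurable_modular f :
  measurable_fun setT f -> measurable_fun setT (fun x => phi `|f x|%R).
Proof.
move=> mf; apply: (@measurableT_comp _ _ _ _ _ _ (fun y : R => phi `|y|%R)) => //.
by apply: ge0_homo_measurable => u v; exact: orlicz_homo.
Qed.

Lemma measurable_modular_complementary f :
  measurable_fun setT f -> measurable_fun setT (fun x => psi `|f x|%R).
Proof.
move=> mf; apply: (@measurableT_comp _ _ _ _ _ _ (fun y : R => psi `|y|%R)) => //.
by apply: ge0_homo_measurable => u v _; exact: complementary_homo.
Qed.

Lemma modular_homo f g :
  measurable_fun setT f -> measurable_fun setT g ->
  (forall x, `|f x| <= `|g x|)%R -> modular phi f <= modular phi g.
Proof.
move=> mf mg fg; apply: ge0_le_integral => //.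
- by move=> x _; exact: orlicz_ge0.
- exact: measurable_modular.
- exact: measurable_modular.
- by move=> x _; exact: orlicz_homo.
Qed.

Lemma in_orlicz_scale (a : R) f : measurable_fun setT f ->
  in_orlicz phi f -> in_orlicz phi (fun x => a * f x)%R.
Proof.
move=> mf [l l0 fl].
have a1 : (0 < `|a| + 1)%R by rewrite ltr_wpDl.
exists (l / (`|a| + 1))%R; first exact: divr_gt0.
apply: le_lt_trans fl; apply: modular_homo => [||x].
- by do 2 apply: measurable_funM => //.
- exact: measurable_funM.
rewrite mulrA !normrM normfV (gtr0_norm l0) (gtr0_norm a1).
rewrite ler_wpM2r// mulrAC ler_pdivrMr//; apply: ler_wpM2l; first exact: ltW.
by rewrite lerDl.
Qed.

Lemma in_orliczD f g : measurable_fun setT f -> measurable_fun setT g ->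
  in_orlicz phi f -> in_orlicz phi g -> in_orlicz phi (fun x => f x + g x)%R.
Proof.
move=> mf mg [l l0 fl] [m m0 gm]; pose k := Num.min l m.
have k0 : (0 < k)%R by rewrite lt_min l0.
have h0 : (0 <= 2^-1 :> R)%R by rewrite invr_ge0.
have hE : (1 - 2^-1 = 2^-1 :> R)%R by rewrite {1}(splitr 1) mul1r addrK.
have h1 : (2^-1 <= 1 :> R)%R by rewrite -subr_ge0 hE.
have mM (a : R) (h : T -> R) : measurable_fun setT h ->
    measurable_fun setT (fun x => a * h x)%R.
  by move=> mh; exact: measurable_funM.
exists (2^-1 * k)%R; first by rewrite mulr_gt0// invr_gt0.
have mk (h : T -> R) (n : R) : measurable_fun setT h -> (0 < n)%R -> (k <= n)%R ->
    modular phi (fun x => n * h x)%R < +oo ->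
    modular phi (fun x => k * h x)%R < +oo.
  move=> mh n0 kn; apply: le_lt_trans; apply: modular_homo; [exact: mM|exact: mM|].
  by move=> x; rewrite !normrM ler_wpM2r// !gtr0_norm.
have kl : (k <= l)%R by rewrite ge_min lexx.
have km : (k <= m)%R by rewrite ge_min lexx orbT.
have {fl} fk := mk f l mf l0 kl fl.
have {gm} gk := mk g m mg m0 km gm.
have mfk := measurable_modular (mM k _ mf).
have mgk := measurable_modular (mM k _ mg).
have p0 (h : T -> R) x : [set: T] x -> 0 <= phi `|h x|%R.
  by move=> _; exact: orlicz_ge0.
have p0f := p0 (fun x => k * f x)%R; have p0g := p0 (fun x => k * g x)%R.
apply: (@le_lt_trans _ _ (2^-1%:E * modular phi (fun x => k * f x)%R +
                          2^-1%:E * modular phi (fun x => k * g x)%R)).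
  have p2 (h : T -> R) x : [set: T] x -> 0 <= (2^-1)%:E * phi `|h x|%R.
    by move=> _; apply: mule_ge0; rewrite ?lee_fin//; exact: p0.
  have p2f := p2 (fun x => k * f x)%R; have p2g := p2 (fun x => k * g x)%R.
  have mf2 := measurable_funeM (2^-1)%:E mfk.
  have mg2 := measurable_funeM (2^-1)%:E mgk.
  rewrite /modular -!ge0_integralZl// -ge0_integralD//.
  apply: ge0_le_integral => //.
  - exact: (p0 (fun x => 2^-1 * k * (f x + g x))%R).
  - by apply: measurable_modular; apply: mM; exact: measurable_funD.
  - exact: emeasurable_funD.
  - move=> x _ /=.
    have := @orlicz_convex _ _ hphi `|k * f x|%R `|k * g x|%R 2^-1
      (normr_ge0 _) (normr_ge0 _) h0 h1.
    rewrite hE; apply: le_trans; apply: (orlicz_homo hphi) => //.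
    rewrite -mulrA normrM (ger0_norm h0) -[leRHS]mulrDr.
    by rewrite ler_wpM2l// [X in `|X|%R]mulrDr ler_normD.
by apply: lte_add_pinfty; apply: lte_mul_pinfty; rewrite ?lee_fin//.
Qed.

Lemma in_orlicz0 : in_orlicz phi (fun=> 0%R : R).
Proof.
exists 1%R => //; rewrite /modular.
under eq_integral do rewrite mulr0 normr0 (orlicz0 hphi).
by rewrite integral0.
Qed.

Definition orlicz_pred of orlicz_function phi : {pred {mfun T >-> R}} :=
  fun f : {mfun T >-> R} => `[< in_orlicz phi f >].

Lemma orlicz_predP (f : {mfun T >-> R}) :
  reflect (in_orlicz phi f) (f \in orlicz_pred hphi).
Proof. exact: asboolP. Qed.

Lemma orlicz_submod_closed : submod_closed (orlicz_pred hphi).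
Proof.
split; first by apply/orlicz_predP; exact: in_orlicz0.
move=> a f g /orlicz_predP hf /orlicz_predP hg; apply/orlicz_predP.
apply: (@in_orliczD (fun x => a * f x)%R g) => //.
  exact: measurable_funM.
exact: in_orlicz_scale.
Qed.

HB.instance Definition _ :=
  GRing.isSubmodClosed.Build _ _ (orlicz_pred hphi) orlicz_submod_closed.

Definition orlicz_fun := {f : {mfun T >-> R} | f \in orlicz_pred hphi}.
HB.instance Definition _ := SubChoice.on orlicz_fun.
HB.instance Definition _ := [SubChoice_isSubLmodule of orlicz_fun by <:].


Lemma orlicz_pairing_integrable f (g : {mfun T >-> R}) :
  measurable_fun setT f -> in_orlicz phi f -> modular psi g <= 1 ->
  mu.-integrable setT (fun x => (f x * g x)%:E).
Proof.
move=> mf [l l0 fl] g1.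
have mlf : measurable_fun setT (fun x => l * f x)%R by exact: measurable_funM.
have mfg : measurable_fun setT (fun x => (f x * g x)%:E).
  by apply/measurable_EFinP; exact: measurable_funM.
have m1 := measurable_modular mlf.
have m2 : measurable_fun setT (fun x => psi `|g x|%R).
  exact: measurable_modular_complementary.
have p1 x : [set: T] x -> 0 <= phi `|l * f x|%R by move=> _; exact: orlicz_ge0.
have p2 x : [set: T] x -> 0 <= psi `|g x|%R.
  by move=> _; exact: complementary_ge0.
apply/integrableP; split => //.
have le1 : \int[mu]_x (l%:E * `|(f x * g x)%:E|) <=
    modular phi (fun x => l * f x)%R + modular psi g.
  rewrite /modular -ge0_integralD//; apply: ge0_le_integral => //.
  - by move=> x _; rewrite mule_ge0// lee_fin ltW.
  - by apply: measurable_funeM; exact: measurableT_comp.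
  - exact: emeasurable_funD.
  - move=> x _; apply: le_trans (young hphi _ (normr_ge0 _)).
    by rewrite abse_EFin -EFinM lee_fin !normrM (gtr0_norm l0) mulrA mulrC.
move: le1; rewrite ge0_integralZl//; last 2 first.
- exact: measurableT_comp.
- by rewrite lee_fin ltW.
move=> le1; have : l%:E * \int[mu]_x `|(f x * g x)%:E| < +oo.
  apply: le_lt_trans le1 _; rewrite lte_add_pinfty//.
  by apply: le_lt_trans g1 _; rewrite ltry.
have : 0 <= \int[mu]_x `|(f x * g x)%:E| by exact: integral_ge0.
case: (\int[mu]_x _) => [r _ _|_|//]; first exact: ltry.
by rewrite gt0_muley ?lte_fin.
Qed.

Lemma orlicz_pairing_le f (g : {mfun T >-> R}) (l : R) :
  measurable_fun setT f -> (0 < l)%R ->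
  modular phi (fun x => l * f x)%R < +oo -> modular psi g <= 1 ->
  \int[mu]_x (f x * g x)%:E <=
    l^-1%:E * (modular phi (fun x => l * f x)%R + 1).
Proof.
move=> mf l0 fl g1.
have mlf : measurable_fun setT (fun x => l * f x)%R by exact: measurable_funM.
have mfg : measurable_fun setT (fun x => (f x * g x)%:E).
  by apply/measurable_EFinP; exact: measurable_funM.
have m1 := measurable_modular mlf.
have m2 : measurable_fun setT (fun x => psi `|g x|%R).
  exact: measurable_modular_complementary.
have p1 x : [set: T] x -> 0 <= phi `|l * f x|%R by move=> _; exact: orlicz_ge0.
have p2 x : [set: T] x -> 0 <= psi `|g x|%R.
  by move=> _; exact: complementary_ge0.
have lK (X : \bar R) : X = l^-1%:E * (l%:E * X).
  by rewrite muleA -EFinM mulVf ?gt_eqF// mul1e.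
rewrite [leLHS]lK; apply: lee_wpmul2l; first by rewrite lee_fin invr_ge0 ltW.
rewrite -integralZl//; last first.
  by apply: orlicz_pairing_integrable => //; exists l.
apply: (@le_trans _ _ (modular phi (fun x => l * f x)%R + modular psi g)).
  apply: (le_trans (lee_abs _)).
  apply: (le_trans (le_abse_integral _ _ _)) => //.
    exact: measurable_funeM.
  rewrite /modular -ge0_integralD//; apply: ge0_le_integral => //.
  - by do 2 apply: measurableT_comp => //; exact: measurable_funeM.
  - exact: emeasurable_funD.
  - move=> x _; apply: le_trans (young hphi _ (normr_ge0 _)).
    by rewrite -EFinM abse_EFin lee_fin !normrM mulrA mulrC.
exact: leeD2l.
Qed.

Lemma modular_complementary0 : modular psi (cst 0%R : {mfun T >-> R}) = 0.
Proof.
rewrite /modular; under eq_integral do rewrite normr0 (complementary0 hphi).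
by rewrite integral0.
Qed.

Lemma orlicz_norm_ge0 f : 0 <= orlicz_norm phi f.
Proof.
apply: ereal_sup_ubound; exists (cst 0%R : {mfun T >-> R}) => /=.
  by rewrite modular_complementary0.
by under eq_integral do rewrite mulr0; rewrite integral0.
Qed.

Lemma orlicz_norm_fin_num f : measurable_fun setT f -> in_orlicz phi f ->
  orlicz_norm phi f \is a fin_num.
Proof.
move=> mf [l l0 fl]; rewrite ge0_fin_numE ?orlicz_norm_ge0//.
apply: (@le_lt_trans _ _ (l^-1%:E * (modular phi (fun x => l * f x)%R + 1))).
  by apply: ge_ereal_sup => _ [g /= g1 <-]; exact: orlicz_pairing_le.
rewrite lte_mul_pinfty ?lee_fin ?invr_ge0 ?ltW//.
by rewrite lte_add_pinfty// ltry.
Qed.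

Lemma orlicz_normD f g : measurable_fun setT f -> in_orlicz phi f ->
  measurable_fun setT g -> in_orlicz phi g ->
  orlicz_norm phi (fun x => f x + g x)%R <= orlicz_norm phi f + orlicz_norm phi g.
Proof.
move=> mf hf mg hg; apply: ge_ereal_sup => _ [h /= h1 <-].
under eq_integral do rewrite mulrDl EFinD.
rewrite integralD//; [|exact: orlicz_pairing_integrable..].
by apply: leeD; apply: ereal_sup_ubound; exists h.
Qed.

Lemma orlicz_normZ_le (a : R) f : measurable_fun setT f -> in_orlicz phi f ->
  orlicz_norm phi (fun x => a * f x)%R <= `|a|%:E * orlicz_norm phi f.
Proof.
move=> mf hf; apply: ge_ereal_sup => _ [g /= g1 <-].
have key (h : {mfun T >-> R}) : modular psi h <= 1 ->
    `|a|%:E * \int[mu]_x (f x * h x)%:E <= `|a|%:E * orlicz_norm phi f.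
  by move=> h1; apply: lee_wpmul2l => //; apply: ereal_sup_ubound; exists h.
have [a0|a0] := leP 0%R a.
  apply: le_trans (key _ g1); rewrite (ger0_norm a0) -integralZl//.
    rewrite le_eqVlt; apply/orP; left; apply/eqP; apply: eq_integral => x _ /=.
    by rewrite -EFinM mulrA.
  exact: orlicz_pairing_integrable.
have Ng1 : modular psi (- g)%R <= 1.
  by rewrite /modular; under eq_integral do rewrite /= normrN.
apply: le_trans (key _ Ng1); rewrite (ltr0_norm a0) -integralZl//.
  rewrite le_eqVlt; apply/orP; left; apply/eqP; apply: eq_integral => x _ /=.
  rewrite -[RHS]/((- a)%:E * (f x * - g x)%:E).
  by rewrite -EFinM mulrN mulrNN mulrA.
exact: orlicz_pairing_integrable.
Qed.

Lemma orlicz_normZ (a : R) f : measurable_fun setT f -> in_orlicz phi f ->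
  orlicz_norm phi (fun x => a * f x)%R = `|a|%:E * orlicz_norm phi f.
Proof.
move=> mf hf; apply/eqP; rewrite eq_le orlicz_normZ_le//=.
have [->|a0] := eqVneq a 0%R; first by rewrite normr0 mul0e orlicz_norm_ge0.
have maf : measurable_fun setT (fun x => a * f x)%R by exact: measurable_funM.
have := @orlicz_normZ_le a^-1%R _ maf (in_orlicz_scale a mf hf).
under eq_fun do rewrite mulKf//.
have a1 : 0 <= `|a|%:E by rewrite lee_fin.
move=> /(lee_wpmul2l a1) /le_trans; apply.
by rewrite muleA -EFinM -normrM mulfV// normr1 mul1e.
Qed.

Lemma orlicz_norm_ae_eq f g :
  measurable_fun setT f -> measurable_fun setT g ->
  {ae mu, forall x, f x = g x} -> orlicz_norm phi f = orlicz_norm phi g.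
Proof.
move=> mf mg fg; congr ereal_sup; apply/seteqP; split=> _ [h /= h1 <-];
  exists h => //; apply: ae_eq_integral => //.
1,2,4,5: by apply/measurable_EFinP; exact: measurable_funM.
- by apply: filterS fg => x -> _.
- by apply: filterS fg => x -> _.
Qed.

Lemma orlicz_norm_eq0 f : measurable_fun setT f -> in_orlicz phi f ->
  orlicz_norm phi f = 0 -> {ae mu, forall x, f x = 0%R}.
Proof.
move=> mf hf f0.
have [F FT Foo] := sigma_finiteT mu.
suff Fae n : {ae mu, forall x, F n x -> f x = 0%R}.
  apply: filterS (ae_foralln Fae) => x fx.
  have : setT x by [].
  by rewrite FT => -[n _]; exact: fx.
have [mF Fn] := Foo n.
have [c c0 cM] := complementary_small hphi (fine (mu (F n))).
have mg : measurable_fun setT (fun x => c * (Num.sg (f x) * \1_(F n) x))%R.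
  apply: measurable_funM => //; apply: measurable_funM => //.
  apply: measurableT_comp => //; apply: nondecreasing_measurable => // a b.
  by case: (sgrP a) => a0; case: (sgrP b) => b0 ab; lra.
pose g : {mfun T >-> R} := HB.pack (fun x => c * (Num.sg (f x) * \1_(F n) x))%R
  (isMeasurableFun.Build _ _ _ _ _ mg).
have g1 : modular psi g <= 1.
  apply: (@le_trans _ _ (\int[mu]_x (psi c * (\1_(F n) x)%:E))).
    apply: ge0_le_integral => //.
    - by move=> x _; exact: complementary_ge0.
    - exact: measurable_modular_complementary.
    - by apply: measurable_funeM; exact/measurable_EFinP.
    - move=> x _; rewrite /g/= indicE; case: (x \in F n) => /=.
        rewrite mulr1 mule1; apply: complementary_homo.
        rewrite normrM (gtr0_norm c0) normr_sg ler_piMr//; first exact: ltW.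
        by case: eqP.
      by rewrite !mulr0 normr0 (complementary0 hphi) mule0.
  rewrite ge0_integralZl//; last 2 first.
  - exact/measurable_EFinP.
  - exact: complementary_ge0.
  by rewrite fineK ?ge0_fin_numE// in cM; rewrite integral_indic// setIT.
have le0 : \int[mu]_x (f x * g x)%:E <= 0.
  by rewrite -f0; apply: ereal_sup_ubound; exists g.
have mh : measurable_fun setT (fun x => (`|f x| * \1_(F n) x)%:E).
  apply/measurable_EFinP; apply: measurable_funM => //.
  exact: measurableT_comp.
have h0 : \int[mu]_x `|(`|f x| * \1_(F n) x)%:E| = 0.
  apply/eqP; rewrite eq_le integral_ge0// andbT.
  rewrite -(@lee_pmul2l _ c%:E)// ?lte_fin// mule0.
  rewrite -ge0_integralZl//; last 2 first.
  - exact: measurableT_comp.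
  - by rewrite lee_fin ltW.
  apply: le_trans le0; rewrite le_eqVlt; apply/orP; left; apply/eqP.
  apply: eq_integral => x _ /=; rewrite -EFinM; congr EFin.
  rewrite normrM normr_id (@ger0_norm _ (\1_(F n) x)) ?indicE//.
  by rewrite [RHS]mulrCA; congr (_ * _)%R; rewrite normrEsg mulrA [(f x * _)%R]mulrC.
move/(ae_eq_integral_abs _ measurableT mh): h0; apply: filterS => x /(_ I) /=.
move=> [/eqP]; rewrite mulf_eq0 normr_eq0 => /orP[/eqP//|].
by rewrite indicE => + Fx; rewrite mem_set// oner_eq0.
Qed.

Definition ae_null : {pred orlicz_fun} :=
  fun f : orlicz_fun => `[< {ae mu, forall x, \val f x = 0%R} >].

Lemma ae_nullP (f : orlicz_fun) :
  reflect {ae mu, forall x, \val f x = 0%R} (f \in ae_null).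
Proof. exact: asboolP. Qed.

Lemma orlicz_funD (f g : orlicz_fun) x : (\val (f + g) x = \val f x + \val g x)%R.
Proof. by []. Qed.

Lemma orlicz_funZ (a : R) (f : orlicz_fun) x : (\val (a *: f) x = a * \val f x)%R.
Proof. by []. Qed.

Lemma orlicz_funB (f g : orlicz_fun) x : (\val (f - g) x = \val f x - \val g x)%R.
Proof. by []. Qed.

Lemma measurable_orlicz_fun (f : orlicz_fun) : measurable_fun setT (\val f).
Proof. by []. Qed.

Lemma orlicz_funP (f : orlicz_fun) : in_orlicz phi (\val f).
Proof. exact/orlicz_predP/(valP f). Qed.

Lemma ae_null_submod_closed : submod_closed ae_null.
Proof.
split; first by apply/ae_nullP; exact: aeW.
move=> a f g /ae_nullP hf /ae_nullP hg; apply/ae_nullP.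
apply: filterS2 hf hg => x /= fx gx.
rewrite [LHS](orlicz_funD (a *: f) g) (orlicz_funZ a f) fx gx.
by rewrite mulr0 addr0.
Qed.

HB.instance Definition _ :=
  GRing.isSubmodClosed.Build _ _ ae_null ae_null_submod_closed.

(* Quotient.quot ae_null identifies f and g when f - g is in ae_null. *)
Definition orlicz_space := Quotient.quot ae_null.
HB.instance Definition _ := GRing.Zmodule.on orlicz_space.
HB.instance Definition _ := EqQuotient.on orlicz_space.

Local Open Scope quotient_scope.
Local Open Scope ring_scope.

Definition orlicz_pi : orlicz_fun -> orlicz_space := \pi_orlicz_space.

Lemma orlicz_piP (f g : orlicz_fun) :
  orlicz_pi f = orlicz_pi g <-> {ae mu, forall x, \val f x = \val g x}.
Proof.
have E : orlicz_pi f = orlicz_pi g <-> f - g \in ae_null.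
  rewrite /orlicz_pi Quotient.idealrBE; exact: (rwP eqP).
split=> [/E/ae_nullP|fg]; first apply: filterS.
  by move=> x; rewrite orlicz_funB => /eqP; rewrite subr_eq0 => /eqP.
apply/E/ae_nullP; apply: filterS fg => x.
by rewrite orlicz_funB => ->; rewrite subrr.
Qed.

Lemma orlicz_pi_repr (q : orlicz_space) : orlicz_pi (repr q) = q.
Proof. exact: reprK. Qed.

Lemma orlicz_piD (f g : orlicz_fun) :
  orlicz_pi (f + g) = (orlicz_pi f + orlicz_pi g)%R.
Proof. exact: Quotient.pi_add. Qed.

Lemma orlicz_pi0 : orlicz_pi 0 = 0.
Proof. by apply: (addrI (orlicz_pi 0)); rewrite -orlicz_piD !addr0. Qed.

Definition orlicz_scale (a : R) (q : orlicz_space) : orlicz_space :=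
  orlicz_pi (a *: repr q).

Lemma orlicz_scale_pi (a : R) (f : orlicz_fun) :
  orlicz_scale a (orlicz_pi f) = orlicz_pi (a *: f).
Proof.
apply/orlicz_piP.
have /orlicz_piP := orlicz_pi_repr (orlicz_pi f).
by apply: filterS => x; rewrite !orlicz_funZ => ->.
Qed.

Lemma orlicz_scaleA (a b : R) (q : orlicz_space) :
  orlicz_scale a (orlicz_scale b q) = orlicz_scale (a * b)%R q.
Proof. by rewrite -(orlicz_pi_repr q) !orlicz_scale_pi scalerA. Qed.

Lemma orlicz_scale1 : left_id 1%R orlicz_scale.
Proof. by move=> q; rewrite -(orlicz_pi_repr q) orlicz_scale_pi scale1r. Qed.

Lemma orlicz_scaleDr : right_distributive orlicz_scale +%R.
Proof.
move=> a p q; rewrite -(orlicz_pi_repr p) -(orlicz_pi_repr q).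
by rewrite -orlicz_piD !orlicz_scale_pi scalerDr orlicz_piD.
Qed.

Lemma orlicz_scaleDl (q : orlicz_space) :
  {morph orlicz_scale^~ q : a b / (a + b)%R}.
Proof.
move=> a b; rewrite -(orlicz_pi_repr q).
by rewrite !orlicz_scale_pi scalerDl orlicz_piD.
Qed.

HB.instance Definition _ := GRing.Zmodule_isLmodule.Build R orlicz_space
  orlicz_scaleA orlicz_scale1 orlicz_scaleDr orlicz_scaleDl.

Lemma orlicz_piZ (a : R) (f : orlicz_fun) :
  orlicz_pi (a *: f) = (a *: orlicz_pi f)%R.
Proof. by rewrite -orlicz_scale_pi. Qed.

Definition orlicz_space_norm (q : orlicz_space) : R :=
  fine (orlicz_norm phi (\val (repr q))).

Lemma orlicz_space_norm_pi (f : orlicz_fun) :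
  (orlicz_space_norm (orlicz_pi f))%:E = orlicz_norm phi (\val f).
Proof.
rewrite /orlicz_space_norm fineK; last first.
  by apply: orlicz_norm_fin_num => //; exact: orlicz_funP.
apply: orlicz_norm_ae_eq => //.
exact/orlicz_piP/orlicz_pi_repr.
Qed.

Lemma orlicz_space_normD (p q : orlicz_space) :
  (orlicz_space_norm (p + q) <= orlicz_space_norm p + orlicz_space_norm q)%R.
Proof.
rewrite -(orlicz_pi_repr p) -(orlicz_pi_repr q) -orlicz_piD.
rewrite -lee_fin EFinD !orlicz_space_norm_pi.
exact: (orlicz_normD (measurable_orlicz_fun _) (orlicz_funP _)
  (measurable_orlicz_fun _) (orlicz_funP _)).
Qed.

Lemma orlicz_space_normZ (a : R) (q : orlicz_space) :
  (orlicz_space_norm (a *: q) = `|a| * orlicz_space_norm q)%R.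
Proof.
rewrite -(orlicz_pi_repr q) -orlicz_piZ.
apply: EFin_inj; rewrite EFinM !orlicz_space_norm_pi.
exact: (orlicz_normZ a (measurable_orlicz_fun _) (orlicz_funP _)).
Qed.

Lemma orlicz_space_norm0_eq0 (q : orlicz_space) :
  orlicz_space_norm q = 0%R -> q = 0%R.
Proof.
move=> q0; have {q0} := congr1 EFin q0.
rewrite -(orlicz_pi_repr q) orlicz_space_norm_pi => q0.
rewrite -orlicz_pi0; apply/orlicz_piP.
exact: (orlicz_norm_eq0 (measurable_orlicz_fun _) (orlicz_funP _) q0).
Qed.

HB.instance Definition _ := @Lmodule_isNormed.Build R orlicz_space
  orlicz_space_norm orlicz_space_normD orlicz_space_normZ orlicz_space_norm0_eq0.

End orlicz_space.

(* Main.v *)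
(* For psi = phi_* and a set A with psi(a) mu(A) = 1, the functional f |-> int f g with
   g = a 1_A has norm one on the Orlicz space. For every h in the unit ball of L_psi,
   g + h or g - h has norm at most some 1 / k < 2 independent of h: on A one of the two
   signs produces a cancellation, and since psi is not linear on [0, a] we have
   psi(a / 2) < psi(a) / 2, which leaves a definite gap in the convexity estimate for the
   modular of (g +- h) / 2. Writing
     int (p - q) h = int p (g + h) + int q (g - h) - int p g - int q g
   for p, q in a thin slice defined by g then bounds the diameter of that slice away
   from 2. In the non-atomic case a lies strictly between d and b, so psi stays finite
   beyond a; for the counting measure A is a point and a = c, and choosing the
   cancelling sign at that point makes values of psi beyond c unnecessary. *)
Require Import Defs.
From HB Require Import structures.
From mathcomp Require Import all_boot all_order all_algebra.
From mathcomp Require Import all_classical all_reals all_analysis.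
From mathcomp Require Import measurable_realfun lra.
Import Order.TTheory GRing.Theory Num.Theory.
Import numFieldNormedType.Exports.

Local Open Scope classical_set_scope.
Local Open Scope ring_scope.
Local Open Scope ereal_scope.

(** * Convexity of the complementary function and its gap below the chord *)

Section complementary_convexity.
Set Implicit Arguments.
Unset Strict Implicit.
Variables (R : realType) (phi : R -> \bar R).
Hypothesis hphi : orlicz_function phi.
Local Notation psi := (complementary phi).

Lemma complementary_convex (u v t : R) : (0 <= t <= 1)%R ->
  psi (t * u + (1 - t) * v)%R <= t%:E * psi u + (1 - t)%:E * psi v.
Proof.
move=> /andP[t0 t1]; apply: ge_ereal_sup => _ [w /= w0 <-].
have hw x : (x * w)%:E - phi w <= psi x by apply: ereal_sup_ubound; exists w.
have := orlicz_ge0 hphi w0; have := hw u; have := hw v.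
case: (phi w) => [r||]//=; rewrite ?addeNy ?leNye// => hv hu _.
apply: (@le_trans _ _ (t%:E * (u * w - r)%:E + (1 - t)%:E * (v * w - r)%:E)).
  by rewrite -!EFinM -EFinD lee_fin; lra.
by apply: leeD; apply: lee_wpmul2l => //; rewrite lee_fin// subr_ge0.
Qed.

Lemma complementary_scale (u t : R) : (0 <= t <= 1)%R ->
  psi (t * u)%R <= t%:E * psi u.
Proof.
move=> /(complementary_convex u 0%R).
by rewrite mulr0 addr0 (complementary0 hphi) mule0 adde0.
Qed.

Lemma orlicz_d_ge0 : 0 <= orlicz_d psi.
Proof.
apply: ereal_sup_ubound; exists 0%R => //; split => //.
exists 0%R => // v v0 v0'.
have -> : v = 0%R by apply/eqP; rewrite eq_le v0 v0'.
by rewrite (complementary0 hphi) mulr0.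
Qed.

(** If [psi (a / 2)] were at least half of [psi a], then [psi] would be linear on [0, a]: convexity
    puts [psi v] and [psi (a - v)] below the chord, while their average is at least [psi (a / 2)],
    so both lie on the chord. This contradicts d < a. *)
Lemma orlicz_d_midpoint (a : R) : orlicz_d psi < a%:E -> psi a < +oo ->
  exists p q : R,
    [/\ psi a = p%:E, psi (a / 2)%R = q%:E & (0 <= q < p / 2)%R].
Proof.
move=> da psia.
have a0 : (0 < a)%R by rewrite -lte_fin (le_lt_trans orlicz_d_ge0).
have fin v : (v <= a)%R -> psi v = (fine (psi v))%:E.
  move=> va; rewrite fineK// ge0_fin_numE ?complementary_ge0//.
  by apply: le_lt_trans psia; exact: complementary_homo.
have a2 : (a / 2 <= a)%R by lra.
exists (fine (psi a)), (fine (psi (a / 2)%R)).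
rewrite -!fin//; split => //.
rewrite fine_ge0 ?complementary_ge0//= ltNge; apply/negP => mid.
suff : a%:E <= orlicz_d psi by rewrite leNgt da.
apply: ereal_sup_ubound; exists a => //; split; first exact: ltW.
set p := fine (psi a); exists (p / a)%R.
  by rewrite divr_ge0 ?fine_ge0 ?complementary_ge0// ltW.
have chord v : (0 <= v)%R -> (v <= a)%R -> (fine (psi v) <= p / a * v)%R.
  move=> v0 va; have t01 : (0 <= v / a <= 1)%R.
    by rewrite ler_pdivrMr// mul1r va andbT divr_ge0// ltW.
  have := complementary_scale a t01.
  rewrite divfK ?gt_eqF// fin// [psi a]fin// -EFinM lee_fin.
  by rewrite -/p; lra.
move=> v v0 va; rewrite fin//; congr EFin; apply/eqP.
rewrite eq_le chord//=.
have av0 : (0 <= a - v)%R by rewrite subr_ge0.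
have ava : (a - v <= a)%R by lra.
have := chord _ av0 ava.
have h01 : (0 <= (2^-1 : R) <= 1)%R by lra.
have := complementary_convex v (a - v)%R h01.
have -> : (2^-1 * v + (1 - 2^-1) * (a - v) = a / 2)%R by lra.
rewrite [psi (a / 2)]fin// (fin v va) (fin _ ava) -!EFinM -EFinD lee_fin.
have -> : (p / a * (a - v) = p - p / a * v)%R.
  by rewrite mulrBr divfK ?gt_eqF.
rewrite -/p in mid *; lra.
Qed.

(* Where g and h have opposite signs, |g + h| / 2 is at most max(|g|, |h|) / 2. *)
Lemma complementary_dist_le (k a u : R) : (0 <= k <= 1)%R -> (0 <= a)%R ->
  (0 <= u)%R -> psi (k * `|a - u|)%R <= k%:E * psi u + psi (k * a)%R.
Proof.
move=> k01 a0 u0; have /andP[k0 k1] := k01.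
have [ua|au] := leP u a.
  apply: (@le_trans _ _ (psi (k * a)%R)).
    by apply: complementary_homo; rewrite ler_wpM2l// ger0_norm; lra.
  by rewrite leeDr// mule_ge0 ?lee_fin// complementary_ge0.
apply: (@le_trans _ _ (psi (k * u)%R)).
  by apply: complementary_homo; rewrite ler_wpM2l// ltr0_norm; lra.
apply: (le_trans (complementary_scale _ k01)).
by rewrite leeDl// complementary_ge0.
Qed.

(** Used where g and h have the same sign. As [k * a] is absorbed by [(1 - k) * b], the argument is
    at most a convex combination of [u] and [b]. For k > 1/2 and a > 0 the hypothesis forces b > a,
    whence the need for finite values of [psi] beyond a. *)
Lemma complementary_add_le (k a b u : R) : (0 <= k < 1)%R ->
  (k * a <= (1 - k) * b)%R ->
  psi (k * (a + u))%R <= k%:E * psi u + (1 - k)%:E * psi b.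
Proof.
move=> /andP[k0 k1] kab.
have k01 : (0 <= k <= 1)%R by rewrite k0 ltW.
apply: le_trans (complementary_convex u b k01).
by apply: complementary_homo; lra.
Qed.

End complementary_convexity.

(** * Sets of prescribed measure in a non-atomic space *)

Section nonatomic_intermediate_value.
Set Implicit Arguments.
Unset Strict Implicit.
Context d (T : measurableType d) (R : realType).
Variable mu : {sigma_finite_measure set T -> \bar R}.
Hypothesis hmu : nonatomic mu.

(** As E is not an atom, it splits into two pieces of positive measure; the smaller one is taken. *)
Lemma nonatomic_half (E : set T) : measurable E -> 0 < mu E -> mu E < +oo ->
  exists B, [/\ measurable B, B `<=` E, 0 < mu B & mu B <= (2^-1)%:E * mu E].
Proof.
move=> mE E0 Eoo.
have [B [mB BE B0 EB0]] : exists B, [/\ measurable B, B `<=` E,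
    mu B != 0 & mu (E `\` B) != 0].
  apply: contrapT => noB; apply: (hmu (A := E)); split => // B mB BE.
  have [|B0] := eqVneq (mu B) 0; first by left.
  right; apply/eqP; apply: contrapT => /negP EB0.
  by apply: noB; exists B.
have mEB : measurable (E `\` B) by exact: measurableD.
have EE : mu E = mu (E `\` B) + mu B.
  by rewrite [LHS](measureDI mu mE mB) (setIidr BE).
have := measure_ge0 mu B; have := measure_ge0 mu (E `\` B).
rewrite !le_eqVlt ![0 == _]eq_sym (negbTE B0) (negbTE EB0)/= => EB1 B1.
move: EE Eoo E0.
have [bound|bound] := leP (mu B) (mu (E `\` B)) => EE Eoo E0.
  exists B; split => //; move: EE Eoo bound B1 EB1.
  case: (mu E) => [x||]//; case: (mu B) => [y||]//; case: (mu (E `\` B)) => [z||]//.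
  by move=> [->] _; rewrite -EFinM !lee_fin !lte_fin; lra.
exists (E `\` B); split => //; move: EE Eoo bound B1 EB1.
case: (mu E) => [x||]//; case: (mu B) => [y||]//; case: (mu (E `\` B)) => [z||]//.
by move=> [->] _; rewrite -EFinM !lee_fin !lte_fin; lra.
Qed.

(** Sigma-finiteness gives a piece of E of finite positive measure, which is then halved
    repeatedly. *)
Lemma nonatomic_small (E : set T) (e : R) : measurable E -> 0 < mu E ->
  (0 < e)%R ->
  exists B, [/\ measurable B, B `<=` E, 0 < mu B & mu B <= e%:E].
Proof.
move=> mE E0 e0.
have [F [mF FE F0 Foo]] : exists F, [/\ measurable F, F `<=` E, 0 < mu F & mu F < +oo].
  have [G GT Goo] := sigma_finiteT mu.
  apply: contrapT => noF; move: E0; rewrite ltNge => /negP; apply.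
  have mG n : measurable (G n) by have [] := Goo n.
  have -> : E = \bigcup_n (E `&` G n) by rewrite -setI_bigcupr -GT setIT.
  have mEG n : measurable (E `&` G n) by exact: measurableI.
  rewrite measure_le0; apply/eqP/measure_negligible.
    exact: bigcup_measurable.
  apply: negligible_bigcup => n; apply/negligibleP => //.
  apply/eqP; apply: contrapT => /negP EGn; apply: noF.
  exists (E `&` G n); split => //; first by rewrite lt_def EGn measure_ge0.
  have [_] := Goo n; apply: le_lt_trans.
  by apply: le_measure => //; rewrite ?inE//; exact: subIsetr.
have iter n : exists B, [/\ measurable B, B `<=` E, 0 < mu B &
    mu B <= (2^-1 ^+ n)%:E * mu F].
  elim: n => [|n [B [mB BE B0 Bn]]].
    by exists F; split => //; rewrite expr0 mul1e.
  have Boo : mu B < +oo.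
    apply: (le_lt_trans Bn); rewrite -ge0_fin_numE.
      by rewrite fin_numM// ge0_fin_numE// ltW.
    by rewrite mule_ge0 ?lee_fin ?exprn_ge0 ?invr_ge0// ltW.
  have [C [mC CB C0 Ch]] := nonatomic_half mB B0 Boo.
  exists C; split => //; first exact: subset_trans BE.
  apply: (le_trans Ch); rewrite exprS EFinM -muleA.
  by apply: lee_wpmul2l => //; rewrite lee_fin invr_ge0.
pose m := fine (mu F).
have Fm : mu F = m%:E by rewrite fineK// ge0_fin_numE// ltW.
have m0 : (0 < m)%R by rewrite -lte_fin -Fm.
have [n hn] : exists n, (2^-1 ^+ n * m <= e)%R.
  have em : (0 < e / m)%R by rewrite divr_gt0.
  have /cvgrPdist_lt/(_ _ em) : (fun n : nat => (2^-1 : R) ^+ n)%R @ \oo --> (0 : R)%R.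
    by apply: cvg_expr; rewrite gtr0_norm ?invf_lt1 ?ltr1n.
  move=> [n _ /(_ n (leqnn n))]/=; rewrite sub0r normrN ger0_norm.
    by rewrite ltr_pdivlMr// => /ltW; exists n.
  by rewrite exprn_ge0// invr_ge0.
have [B [mB BE B0 Bn]] := iter n; exists B; split => //.
by apply: (le_trans Bn); rewrite Fm -EFinM lee_fin.
Qed.

(* Exhaustion: each step enlarges the set, without exceeding measure t, to within
   2^-n of the best possible, and the union has measure t since otherwise a small
   piece of its complement could still be added. *)
Lemma nonatomic_intermediate (t : R) : (0 <= t)%R -> t%:E < mu [set: T] ->
  exists2 A, measurable A & mu A = t%:E.
Proof.
move=> t0 tT.
pose adm A := measurable A /\ mu A <= t%:E.
(* Admissibility is assumed under the existential so that [choice] returns a total function. *)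
have step (p : nat * set T) : exists B, adm p.2 -> [/\ adm B, p.2 `<=` B &
    forall C, adm C -> p.2 `<=` C -> mu C <= mu B + (2^-1 ^+ p.1)%:E].
  case: p => n A /=; have [admA|nadmA] := pselect (adm A); last by exists A.
  pose S := [set mu C | C in [set C | adm C /\ A `<=` C]].
  have SA : S (mu A) by exists A => //; split.
  have Sfin : ereal_sup S \is a fin_num.
    rewrite ge0_fin_numE; last first.
      by apply: (le_trans (measure_ge0 mu A)); exact: ereal_sup_ubound.
    apply: (@le_lt_trans _ _ t%:E); last exact: ltry.
    by apply: ge_ereal_sup => _ [C [[_ ?] _] <-].
  have e0 : (0 < (2^-1 : R) ^+ n)%R by rewrite exprn_gt0// invr_gt0.
  have [_ [B [admB AB] <-] Bn] := ub_ereal_sup_adherent e0 Sfin.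
  exists B => _; split => // C admC AC.
  rewrite -leeBlDr//; apply/ltW; apply: le_lt_trans Bn.
  by apply: leeB => //; apply: ereal_sup_ubound; exists C.
have [f hf] := choice step.
pose A := fix A n := if n is m.+1 then f (m, A m) else set0.
have admA n : adm (A n).
  by elim: n => [|n /(hf (n, _))[]//]; split => //=; rewrite measure0 lee_fin.
have mA n : measurable (A n) by have [] := admA n.
have Amono n : A n `<=` A n.+1 by have [] := hf (n, A n) (admA n).
have ndA : nondecreasing_seq A.
  by apply/nondecreasing_seqP => n; rewrite subsetEset; exact: Amono.
pose U := \bigcup_n A n.
have mU : measurable U by exact: bigcup_measurable.
have cvgA : (mu \o A) @ \oo --> mu U by exact: nondecreasing_cvg_mu.
have Ut : mu U <= t%:E.
  rewrite -(cvg_lim _ cvgA)//; apply: lime_le; first by apply/cvg_ex; exists (mu U).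
  by apply: nearW => n; have [] := admA n.
exists U => //; apply/eqP; rewrite eq_le Ut/= leNgt; apply/negP => Ult.
pose u := fine (mu U).
have Uu : mu U = u%:E.
  by rewrite fineK// ge0_fin_numE ?measure_ge0// (lt_trans Ult (ltry _)).
have mCU : measurable (~` U) by exact: measurableC.
have CU0 : 0 < mu (~` U).
  rewrite lt_def measure_ge0 andbT; apply/eqP => CU0.
  have TU : mu [set: T] = mu U + mu (~` U).
    by rewrite -(setUv U); apply: measureU => //; exact: setICr.
  by move: tT; rewrite TU CU0 adde0 ltNge Ut.
have ut : (0 < t - u)%R by rewrite subr_gt0 -lte_fin -Uu.
have [B [mB BU B0 Bt]] := nonatomic_small mCU CU0 ut.
have UB0 : U `&` B = set0 by apply/disjoints_subset => x Ux /BU.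
have muUB : mu (U `|` B) = u%:E + mu B by rewrite -Uu; exact: measureU.
have admUB : adm (U `|` B).
  split; first exact: measurableU.
  by rewrite muUB -leeBrDl// EFinB.
pose b := fine (mu B).
have Bb : mu B = b%:E.
  by rewrite fineK// ge0_fin_numE ?measure_ge0// (le_lt_trans Bt (ltry _)).
have b0 : (0 < b)%R by rewrite -lte_fin -Bb.
(* [U] with [B] added competes at every step n, while [A n.+1] is contained in [U]; near-optimality
   of that step leaves at most 2^-n for [B]. *)
have bn n : (b <= 2^-1 ^+ n)%R.
  have sub : A n `<=` U `|` B.
    by apply: subset_trans (@subsetUl _ U B); exact: bigcup_sup.
  have [_ _ /(_ _ admUB sub)] := hf (n, A n) (admA n).
  rewrite -/(A n.+1) muUB Bb /= => ubAn.
  have AnU : mu (A n.+1) <= u%:E.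
    by rewrite -Uu; apply: le_measure; rewrite ?inE//; exact: bigcup_sup.
  by have := le_trans ubAn (leeD2r _ AnU); rewrite -!EFinD lee_fin lerD2l.
have /cvgrPdist_lt/(_ _ b0) : (fun n : nat => (2^-1 : R) ^+ n)%R @ \oo --> (0 : R)%R.
  by apply: cvg_expr; rewrite gtr0_norm ?invf_lt1 ?ltr1n.
move=> [n _ /(_ n (leqnn n))]/=; rewrite sub0r normrN ger0_norm.
  by rewrite ltNge bn.
by rewrite exprn_ge0// invr_ge0.
Qed.

End nonatomic_intermediate_value.

(** * Functionals given by integration, and the diameter of their slices *)

Section orlicz_functional.
Set Implicit Arguments.
Unset Strict Implicit.
Context d (T : measurableType d) (R : realType).
Variable mu : {sigma_finite_measure set T -> \bar R}.
Variables (phi : R -> \bar R) (hphi : orlicz_function phi).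
Local Notation psi := (complementary phi).
Local Notation X := (orlicz_space mu hphi).
Implicit Types (g h : {mfun T >-> R}) (f : orlicz_fun mu hphi).

Definition pairing f g : R := fine (\int[mu]_x (\val f x * g x)%:E).

Lemma pairing_integrable f g : modular mu psi g <= 1 ->
  mu.-integrable setT (fun x => (\val f x * g x)%:E).
Proof.
by move=> g1; apply: (orlicz_pairing_integrable hphi) => //; exact: orlicz_funP.
Qed.

Lemma pairingE f g : modular mu psi g <= 1 ->
  (pairing f g)%:E = \int[mu]_x (\val f x * g x)%:E.
Proof.
move=> g1; rewrite /pairing fineK//.
by apply: integrable_fin_num => //; exact: pairing_integrable.
Qed.

Lemma pairing_linearr f g h (c s : R) :
  modular mu psi g <= 1 -> modular mu psi h <= 1 ->
  \int[mu]_x (\val f x * (c * (g x + s * h x)))%:E =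
  (c * (pairing f g + s * pairing f h))%:E.
Proof.
move=> g1 h1.
have ig := pairing_integrable f g1; have ih := pairing_integrable f h1.
rewrite EFinM EFinD EFinM !pairingE// -(integralZl measurableT ih).
rewrite -integralD//; last exact: integrableZl.
rewrite -integralZl//; last by apply: integrableD => //; exact: integrableZl.
by apply: eq_integral => x _; rewrite -[RHS]EFinM; congr EFin; lra.
Qed.

Lemma pairing_linearl g (c : R) f f' : modular mu psi g <= 1 ->
  pairing (c *: f + f')%R g = (c * pairing f g + pairing f' g)%R.
Proof.
move=> g1; apply: EFin_inj; rewrite EFinD EFinM !pairingE//.
have ig := pairing_integrable f g1; have ig' := pairing_integrable f' g1.
rewrite -integralZl// -integralD//; last exact: integrableZl.
apply: eq_integral => x _; rewrite -[RHS]EFinD; congr EFin.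
by rewrite orlicz_funD orlicz_funZ mulrDl mulrA.
Qed.

Lemma pairing_ae_eq g f f' : orlicz_pi f = orlicz_pi f' ->
  pairing f g = pairing f' g.
Proof.
move=> /orlicz_piP ff'; congr fine; apply: ae_eq_integral => //.
1,2: by apply/measurable_EFinP; exact: measurable_funM.
by apply: filterS ff' => x ->.
Qed.

Definition functional g (q : X) : R := pairing (repr q) g.

Lemma functional_pi g f : functional g (orlicz_pi f) = pairing f g.
Proof. by apply: pairing_ae_eq; exact: orlicz_pi_repr. Qed.

Lemma functional_linear g : modular mu psi g <= 1 -> linear (functional g).
Proof.
move=> g1 c p q.
rewrite -(orlicz_pi_repr p) -(orlicz_pi_repr q) -orlicz_piZ -orlicz_piD.
by rewrite !functional_pi pairing_linearl.
Qed.

Definition linear_functional g (g1 : modular mu psi g <= 1) : {linear X -> R} :=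
  HB.pack (functional g)
    (GRing.isLinear.Build R X R _ (functional g) (functional_linear g1)).

Lemma orlicz_normE f : `|orlicz_pi f|%:E = orlicz_norm mu phi (\val f).
Proof. exact: orlicz_space_norm_pi. Qed.

(** Stated for a bare function [u] so that it applies directly to the combinations k (g + s h). *)
Lemma pairing_le_norm f (u : T -> R) : measurable_fun setT u ->
  modular mu psi u <= 1 ->
  \int[mu]_x (\val f x * u x)%:E <= `|orlicz_pi f|%:E.
Proof.
move=> measu u1; rewrite orlicz_normE; apply: ereal_sup_ubound.
pose u' : {mfun T >-> R} := HB.pack u (isMeasurableFun.Build _ _ _ _ _ measu).
by exists u'.
Qed.

Lemma functional_le_norm g (q : X) : modular mu psi g <= 1 ->
  (functional g q <= `|q|)%R.
Proof.
move=> g1; rewrite -(orlicz_pi_repr q) functional_pi -lee_fin pairingE//.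
exact: pairing_le_norm.
Qed.

Lemma normr_functional_le_norm g (q : X) : modular mu psi g <= 1 ->
  (`|functional g q| <= `|q|)%R.
Proof.
move=> g1; rewrite ler_norml functional_le_norm// andbT lerNl.
rewrite -[leLHS]/(- linear_functional g1 q)%R -raddfN -normrN.
exact: functional_le_norm.
Qed.

Lemma functional_continuous g (g1 : modular mu psi g <= 1) :
  continuous (linear_functional g1).
Proof.
apply/linear_bounded_continuous/linear_boundedP.
exists 1%R; split => // M M1 q.
by apply: (le_trans (normr_functional_le_norm q g1)); rewrite ler_peMl// ltW.
Qed.

Lemma dual_norm_functional_le1 g (g1 : modular mu psi g <= 1) :
  dual_norm (linear_functional g1) <= 1.
Proof.
apply: ge_ereal_sup => _ [q q1 <-]; rewrite lee_fin.
exact: le_trans (normr_functional_le_norm q g1) q1.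
Qed.

Lemma modular_midpoint_le1 g h (s : R) : (`|s| <= 1)%R ->
  modular mu psi g <= 1 -> modular mu psi h <= 1 ->
  modular mu psi (fun x => 2^-1 * (g x + s * h x))%R <= 1.
Proof.
move=> s1 g1 h1.
have mg : measurable_fun setT (fun x => psi `|g x|%R).
  exact: measurable_modular_complementary.
have mh : measurable_fun setT (fun x => psi `|h x|%R).
  exact: measurable_modular_complementary.
have half0 : (0 <= (2^-1 : R))%R by rewrite invr_ge0.
have psi0 u := complementary_ge0 hphi u.
apply: (@le_trans _ _ (2^-1%:E * modular mu psi g + 2^-1%:E * modular mu psi h)).
  rewrite /modular -!ge0_integralZl// -ge0_integralD//; last 4 first.
  - by move=> x _; rewrite mule_ge0.
  - exact: measurable_funeM.
  - by move=> x _; rewrite mule_ge0.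
  - exact: measurable_funeM.
  apply: ge0_le_integral => //.
  - apply: measurable_modular_complementary.
    by apply: measurable_funM => //; apply: measurable_funD => //; exact: measurable_funM.
  - by apply: emeasurable_funD; exact: measurable_funeM.
  - move=> x _; have h01 : (0 <= (2^-1 : R) <= 1)%R by lra.
    have := complementary_convex hphi `|g x|%R `|h x|%R h01.
    have -> : (1 - 2^-1 = 2^-1 :> R)%R by lra.
    apply: le_trans; apply: complementary_homo.
    rewrite normrM ger0_norm// -mulrDr ler_wpM2l//.
    by rewrite (le_trans (ler_normD _ _))// lerD2l normrM ler_piMl.
apply: (@le_trans _ _ (2^-1%:E * 1 + 2^-1%:E * 1)).
  by apply: leeD; apply: lee_wpmul2l.
by rewrite !mule1 -EFinD lee_fin; lra.
Qed.

(* <p - q, h> = <p, g + h> + <q, g - h> - <p, g> - <q, g>, where the last two terms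
   are close to 1 on the slice and one of the first two is at most 1 / k < 2. *)
Lemma diameter_slice_le g (g1 : modular mu psi g <= 1) (k e : R) : (0 < k)%R ->
  (forall h, modular mu psi h <= 1 -> exists2 s : R, s = 1%R \/ s = (-1)%R &
    modular mu psi (fun x => k * (g x + s * h x))%R <= 1) ->
  diameter (slice (linear_functional g1) e) <= (k^-1 + 2 * e)%:E.
Proof.
move=> k0 hk; apply: ge_ereal_sup => _ [[p q] [[/= p1 Fp] [q1 Fq]] <-] /=.
move: p1 Fp q1 Fq; rewrite /unit_ball/= /linear_functional/=.
rewrite -(orlicz_pi_repr p) -(orlicz_pi_repr q) !functional_pi.
move: (repr p) (repr q) => f1 f2 p1 Fp q1 Fq.
have -> : (orlicz_pi f1 - orlicz_pi f2 = orlicz_pi (f1 - f2)%R)%R.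
  by rewrite -scaleN1r -orlicz_piZ -orlicz_piD scaleN1r.
rewrite orlicz_normE; apply: ge_ereal_sup => _ [h /= h1 <-].
have -> : \int[mu]_x (\val (f1 - f2)%R x * h x)%:E =
    (pairing f1 h - pairing f2 h)%:E.
  rewrite -pairingE//; congr EFin.
  have := pairing_linearl (-1) f2 f1 h1.
  by rewrite scaleN1r addrC mulN1r [RHS]addrC.
have mgh (c s : R) : measurable_fun setT (fun x => c * (g x + s * h x))%R.
  by apply: measurable_funM => //; apply: measurable_funD => //; exact: measurable_funM.
have bound f (c s : R) : (0 < c)%R -> (`|orlicz_pi f| <= 1)%R ->
    modular mu psi (fun x => c * (g x + s * h x))%R <= 1 ->
    (pairing f g + s * pairing f h <= c^-1)%R.
  move=> c0 f1' /(pairing_le_norm f (mgh c s)).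
  rewrite pairing_linearr// lee_fin => le1.
  by rewrite -[leRHS]mul1r ler_pdivlMr// mulrC (le_trans le1).
have half s : (`|s| <= 1)%R -> modular mu psi (fun x => 2^-1 * (g x + s * h x))%R <= 1.
  by move=> s1; exact: modular_midpoint_le1.
have half0 : (0 < (2^-1 : R))%R by rewrite invr_gt0.
(* The good sign contributes 1/k, the other one 2, and the two values on the slice take away more
   than 2 (1 - e); what remains is 1/k + 2 e. *)
rewrite lee_fin; have [s [->|->] ks] := hk h h1.
  have := bound _ _ _ k0 p1 ks.
  have := bound _ _ (-1)%R half0 q1 (half _ _).
  by rewrite normrN1 lexx invrK => /(_ isT); lra.
have := bound _ _ _ k0 q1 ks.
have := bound _ _ 1%R half0 p1 (half _ _).
by rewrite normr1 lexx invrK => /(_ isT); lra.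
Qed.

End orlicz_functional.

(** * Norm-one functionals given by multiples of indicators *)

Section indicator_functional.
Set Implicit Arguments.
Unset Strict Implicit.
Context d (T : measurableType d) (R : realType).
Variable mu : {sigma_finite_measure set T -> \bar R}.
Variables (phi : R -> \bar R) (hphi : orlicz_function phi).
Local Notation psi := (complementary phi).
Local Notation X := (orlicz_space mu hphi).
Variables (A : set T) (m : R).
Hypotheses (mA : measurable A) (muA : mu A = m%:E).

Lemma integral_scaled_indic (c : R) : (0 <= c)%R ->
  \int[mu]_x (c * \1_A x)%:E = (c * m)%:E.
Proof.
move=> c0; under eq_integral do rewrite EFinM.
rewrite ge0_integralZl//.
- by rewrite integral_indic// setIT EFinM -muA.
- exact/measurable_EFinP.
Qed.

Lemma modular_scaled_indic (chi : R -> \bar R) (a p : R) : (0 <= a)%R ->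
  (0 <= p)%R -> chi 0%R = 0 -> chi a = p%:E ->
  modular mu chi (fun x => a * \1_A x)%R = (p * m)%:E.
Proof.
move=> a0 p0 chi0 chia; rewrite -integral_scaled_indic//.
apply: eq_integral => x _; rewrite indicE; case: (x \in A) => /=.
  by rewrite !mulr1 ger0_norm.
by rewrite !mulr0 normr0.
Qed.

Variables (a p : R) (g : {mfun T >-> R}).
Hypotheses (a0 : (0 <= a)%R) (psia : psi a = p%:E) (pm : (p * m = 1)%R).
Hypothesis gE : forall x, g x = (a * \1_A x)%R.

Lemma modular_indicator : modular mu psi g = 1.
Proof.
have -> : (g : T -> R) = (fun x => a * \1_A x)%R by exact/funext.
have p0 : (0 <= p)%R by rewrite -lee_fin -psia complementary_ge0.
by rewrite (modular_scaled_indic a0 p0 (complementary0 hphi) psia) pm.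
Qed.

(* If v nearly attains the supremum defining psi a, the norm of f = v 1_A is at most
   1 + I_phi(f), which nearly equals the integral of f g. *)
Lemma indicator_almost_norming (x : R) : (0 < x)%R ->
  exists f : orlicz_fun mu hphi,
    (`|orlicz_pi f| <= pairing f g + x)%R /\ (1 - x <= pairing f g)%R.
Proof.
move=> x0.
have m0 : (0 <= m)%R by rewrite -lee_fin -muA.
have mp : (0 < m)%R.
  by rewrite lt_def m0 andbT; apply: contra_eq_neq pm => ->; rewrite mulr0 eq_sym oner_eq0.
have psifin : psi a \is a fin_num by rewrite psia.
(* A defect of x / m in the supremum becomes x after integration over A. *)
have xm0 : (0 < x / m)%R by rewrite divr_gt0.
have [_ [v /= v0 <-]] := ub_ereal_sup_adherent xm0 psifin.
rewrite -/(psi a) psia; have := orlicz_ge0 hphi v0.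
case phiv : (phi v) => [r||]// r0; rewrite lte_fin => vr.
have {vr}vr : (1 - x < (a * v - r) * m)%R.
  by rewrite -pm -{1}(divfK (lt0r_neq0 mp) x) -mulrBl ltr_pM2r.
have mf : measurable_fun setT (fun y => v * \1_A y)%R by exact: measurable_funM.
pose fm : {mfun T >-> R} := HB.pack (fun y => v * \1_A y)%R
  (isMeasurableFun.Build _ _ _ _ _ mf).
have Iphi : modular mu phi (fun y => 1 * (v * \1_A y))%R = (r * m)%:E.
  under [X in modular _ _ X]eq_fun do rewrite mul1r.
  by rewrite (modular_scaled_indic v0 r0 (orlicz0 hphi) phiv).
have hf : in_orlicz mu phi fm by exists 1%R => //; rewrite Iphi ltry.
pose f : orlicz_fun mu hphi := exist _ fm (introT (orlicz_predP mu hphi fm) hf).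
have fg : pairing f g = (a * v * m)%R.
  rewrite /pairing; have av0 : (0 <= a * v)%R by exact: mulr_ge0.
  rewrite -[RHS]/(fine (a * v * m)%:E) -integral_scaled_indic//; congr fine.
  apply: eq_integral => y _; rewrite gE -[\val f y]/(v * \1_A y)%R indicE.
  by case: (y \in A); rewrite !(mulr1, mulr0)// mulrC.
exists f; rewrite fg; have rm0 : (0 <= r * m)%R by exact: mulr_ge0.
rewrite mulrBl in vr; split; last lra.
rewrite -lee_fin orlicz_normE; apply: (@le_trans _ _ (1 + r * m)%:E); last first.
  by rewrite lee_fin; lra.
apply: ge_ereal_sup => _ [h /= h1 <-].
have lt0 : (0 < (1 : R))%R by [].
have := orlicz_pairing_le hphi mf lt0 _ h1.
by rewrite Iphi ltry invr1 mul1e -EFinD addrC; apply.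
Qed.

Lemma dual_norm_indicator (g1 : modular mu psi g <= 1) :
  dual_norm (linear_functional hphi g1) = 1.
Proof.
apply/eqP; rewrite eq_le dual_norm_functional_le1/=.
apply/lee_addgt0Pr => e e0.
(* After normalisation the defect is x divided by the norm of f. That norm is at least 1 - x, hence
   at least 1/2, so the defect is at most 2 x, hence at most e. *)
pose x := Num.min (e / 2)%R (1 / 2)%R.
have x0 : (0 < x)%R by rewrite lt_min !divr_gt0.
have xe : (x <= e / 2)%R by rewrite ge_min lexx.
have x2 : (x <= 1 / 2)%R by rewrite ge_min lexx orbT.
have [f [nf fg]] := indicator_almost_norming x0.
have fgn : (pairing f g <= `|orlicz_pi f|)%R.
  by rewrite -lee_fin pairingE//; exact: pairing_le_norm.
have n0 : (0 < `|orlicz_pi f|)%R by lra.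
rewrite -leeBlDr//.
have -> : 1 - e%:E = (1 - e)%:E by [].
pose q := (`|orlicz_pi f|^-1 *: orlicz_pi f)%R.
apply: (@le_trans _ _ `|linear_functional hphi g1 q|%:E); last first.
  apply: ereal_sup_ubound; exists q => //.
  by rewrite /unit_ball/= normrZ normfV normr_id mulVf// gt_eqF.
rewrite lee_fin; apply: le_trans (ler_norm _).
rewrite linearZ/= functional_pi -[leRHS]/(_^-1 * _)%R mulrC ler_pdivlMr//.
nra.
Qed.

Lemma slice_small_diameter_not_LD2P (k : R) : (1 / 2 < k)%R ->
  (forall h : {mfun T >-> R}, modular mu psi h <= 1 -> exists2 s : R, s = 1%R \/ s = (-1)%R &
    modular mu psi (fun x => k * (g x + s * h x))%R <= 1) ->
  ~ local_diameter_two_property X.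
Proof.
move=> k2 hk ld2p.
have g1 : modular mu psi g <= 1 by rewrite modular_indicator.
have k0 : (0 < k)%R by lra.
have kV : (k^-1 < 2)%R by rewrite -[ltRHS]invrK ltf_pV2 ?posrE//; lra.
(* With this e the bound 1/k + 2 e is the midpoint of 1/k and 2, hence below 2. *)
pose e := ((2 - k^-1) / 4)%R; have e0 : (0 < e)%R by rewrite /e; lra.
have := diameter_slice_le hphi g1 e k0 hk.
rewrite ld2p//; last first.
  by split; [exact: functional_continuous|exact: dual_norm_indicator].
by rewrite lee_fin /e; lra.
Qed.

End indicator_functional.

(** * Choice of the constants beyond the linear part of [psi] *)

Section orlicz_gain.
Set Implicit Arguments.
Unset Strict Implicit.
Variables (R : realType) (phi : R -> \bar R).
Hypothesis hphi : orlicz_function phi.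
Local Notation psi := (complementary phi).

(** Beyond d the value [psi a] is positive, and convexity with [psi 0 = 0] gives psi(n a) >= n
    psi(a) for n >= 1. *)
Lemma orlicz_d_unbounded (a M : R) : orlicz_d psi < a%:E ->
  exists2 b, (a <= b)%R & M%:E < psi b.
Proof.
move=> da; have [psia|] := ltP (psi a) +oo; last first.
  by rewrite leye_eq => /eqP psia; exists a => //; rewrite psia ltry.
have [p [q [psip psiq /andP[q0 qp]]]] := orlicz_d_midpoint hphi da psia.
have p0 : (0 < p)%R by lra.
have a0 : (0 < a)%R by rewrite -lte_fin (le_lt_trans (orlicz_d_ge0 hphi)).
pose n : R := Num.max 1%R ((`|M| + 1) / p)%R.
have n1 : (1 <= n)%R by rewrite le_max lexx.
have n0 : (0 < n)%R by lra.
have nM : (`|M| + 1 <= n * p)%R by rewrite -ler_pdivrMr// le_max lexx orbT.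
exists (n * a)%R; first by rewrite ler_peMl// ltW.
have nV : (0 <= n^-1 <= 1)%R by rewrite invr_ge0 (ltW n0) invf_le1.
have := complementary_scale hphi (n * a)%R nV.
rewrite mulKf ?gt_eqF// psip; have := complementary_ge0 hphi (n * a)%R.
case: (psi (n * a)%R) => [r||]// _; rewrite ?ltry//.
rewrite -EFinM lee_fin mulrC ler_pdivlMr// lte_fin => pr.
by have := ler_norm M; lra.
Qed.

(** The point [k * a] is the combination of a / 2 and a with weights 2 - 2 k and 2 k - 1, so the gap
    at a / 2 survives for k slightly above 1/2. *)
Lemma complementary_half_le (k a p q : R) : (1 / 2 <= k <= 1)%R ->
  psi a = p%:E -> psi (a / 2)%R = q%:E ->
  psi (k * a)%R <= ((2 - 2 * k) * q + (2 * k - 1) * p)%:E.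
Proof.
move=> k01 psia psia2; have h01 : (0 <= 2 - 2 * k <= 1)%R by lra.
have := complementary_convex hphi (a / 2)%R a h01; rewrite psia psia2 -!EFinM -EFinD.
have -> : ((2 - 2 * k) * (a / 2) + (1 - (2 - 2 * k)) * a = k * a)%R by lra.
by have -> : (1 - (2 - 2 * k) = 2 * k - 1)%R by lra.
Qed.

(** The last inequality is what makes the modulars of k (g + h) and k (g - h) add up to at most 2.
    At k = 1/2 and b = a it holds with slack p / 2 - psi(a / 2) > 0, so there is room to move both k
    and b up a little. *)
Lemma orlicz_gain (a a' p : R) : orlicz_d psi < a%:E -> (a < a')%R ->
  psi a' < +oo -> psi a = p%:E ->
  exists k b c q : R, [/\ (1 / 2 < k < 1)%R, (k * a <= (1 - k) * b)%R,
    psi b = c%:E, psi (k * a)%R = q%:E & (2 * k * p + (1 - k) * c + q <= 2 * p)%R].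
Proof.
move=> da aa' psia' psia.
have a0 : (0 < a)%R by rewrite -lte_fin (le_lt_trans (orlicz_d_ge0 hphi)).
have psiaoo : psi a < +oo by rewrite psia ltry.
have [p1 [q [psip psiq /andP[q0 qp]]]] := orlicz_d_midpoint hphi da psiaoo.
have Ep : p1 = p by apply: EFin_inj; rewrite -psip.
rewrite {}Ep {psip} in qp.
have fin u : psi u < +oo -> psi u = (fine (psi u))%:E.
  by move=> ?; rewrite fineK// ge0_fin_numE ?complementary_ge0.
have psia'E := fin _ psia'.
move: (fine _) psia'E => p' psia'E.
have pp' : (p <= p')%R.
  by rewrite -lee_fin -psia -psia'E; apply: complementary_homo; exact: ltW.
(* [G] is the slack at k = 1/2, b = a, and [D] the growth of [psi] from a to a'. *)
pose G := (p / 2 - q)%R; have G0 : (0 < G)%R by rewrite /G; lra.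
pose D := (p' - p)%R; have D0 : (0 <= D)%R by rewrite /D; lra.
have D1 : (0 < 2 * (D + 1))%R by lra.
(* With b = a + l (a' - a), convexity bounds the excess of [psi b] over p by l D, hence by G / 2. *)
pose l := Num.min 1%R (G / (2 * (D + 1)))%R.
have l0 : (0 < l)%R by rewrite lt_min ltr01 divr_gt0.
have l1 : (l <= 1)%R by rewrite ge_min lexx.
have lD : (l * D <= G / 2)%R.
  have : (l * (2 * (D + 1)) <= G)%R by rewrite -ler_pdivlMr// ge_min lexx orbT.
  by lra.
have l01 : (0 <= l <= 1)%R by rewrite l1 ltW.
have a'a : (0 < a' - a)%R by rewrite subr_gt0.
have p0 : (0 < p)%R by lra.
(* With k = (1 + e) / 2, the first bound keeps k < 1 and the remaining slack (1 - e) G at least G /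
   2. The second limits the added cost e p to G / 4; the excess of [psi b] costs at most another G /
   4. The third gives k a <= (1 - k) b. *)
pose e := Num.min (1 / 2)%R (Num.min (G / (4 * p)) (l * (a' - a) / (4 * a)))%R.
have e0 : (0 < e)%R.
  rewrite !lt_min !divr_gt0// ?mulr_gt0//; lra.
have e2 : (e <= 1 / 2)%R by rewrite ge_min lexx.
have ep : (e * (4 * p) <= G)%R.
  by rewrite -ler_pdivlMr ?ge_min ?lexx ?orbT// mulr_gt0.
have ea : (e * (4 * a) <= l * (a' - a))%R.
  by rewrite -ler_pdivlMr ?ge_min ?lexx ?orbT// mulr_gt0.
pose k := ((1 + e) / 2)%R; pose b := (l * a' + (1 - l) * a)%R.
have psib : psi b <= (l * p' + (1 - l) * p)%:E.
  have := complementary_convex hphi a' a l01.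
  by rewrite psia psia'E -!EFinM -EFinD.
have k01 : (1 / 2 <= k <= 1)%R by rewrite /k; lra.
have psika := complementary_half_le k01 psia psiq.
have psibE := fin b (le_lt_trans psib (ltry _)).
have psikaE := fin (k * a)%R (le_lt_trans psika (ltry _)).
exists k, b, (fine (psi b)), (fine (psi (k * a)%R)); split => //.
- by rewrite /k; lra.
- have : (e * (l * (a' - a)) <= 1 / 2 * (l * (a' - a)))%R.
    by rewrite ler_wpM2r// mulr_ge0// ltW.
  by rewrite /k /b; lra.
move: psib psika; rewrite psibE psikaE !lee_fin => psib psika.
have cb : ((1 - k) * fine (psi b) <= (1 - k) * (l * p' + (1 - l) * p))%R.
  by rewrite ler_wpM2l//; lra.
have eG : (e * G <= 1 / 2 * G)%R by rewrite ler_wpM2r// ltW.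
have elD : (0 <= e * (l * D))%R by rewrite !mulr_ge0// ltW.
apply: (@le_trans _ _ (2 * k * p + (1 - k) * (l * p' + (1 - l) * p) +
   ((2 - 2 * k) * q + (2 * k - 1) * p)))%R; first by lra.
rewrite /k /D /G in eG elD lD ep G0 *; lra.
Qed.

(** Treats finite and infinite total measure alike: the threshold is 1 / M, or 0 if M is
    infinite. *)
Lemma lt1_mule_threshold (M : \bar R) : 0 < M ->
  exists2 t : R, (0 <= t)%R & forall x, 0 <= x -> (1 < x * M) = (t%:E < x).
Proof.
case: M => [r||]// r0.
  rewrite lte_fin in r0; exists r^-1%R; first by rewrite invr_ge0 ltW.
  move=> [x||]// _; last by rewrite gt0_mulye ?lte_fin// !ltry.
  by rewrite -EFinM !lte_fin -ltr_pdivrMr// div1r.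
exists 0%R => // x x0; have [->|xn0] := eqVneq x 0.
  by rewrite mul0e ltxx lte_fin ltr10.
have xp : 0 < x by rewrite lt_def xn0.
by rewrite gt0_muley// xp ltry.
Qed.

(** For finite b, one affine minorant u v - phi(v) of [psi] already exceeds the threshold at b,
    hence also slightly to the left of b. For infinite b, [psi] is unbounded beyond d. *)
Lemma orlicz_level (M : \bar R) : 0 <= M ->
  orlicz_d psi < orlicz_b psi -> 1 < orlicz_at psi (orlicz_b psi) * M ->
  exists2 a : R, orlicz_d psi < a%:E < orlicz_b psi & 1 < psi a * M.
Proof.
move=> M0 db bM.
have Mp : 0 < M.
  rewrite lt_def M0 andbT; apply/eqP => M0'.
  by move: bM; rewrite M0' mule0 lte_fin ltr10.
have [t t0 tM] := lt1_mule_threshold Mp.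
have [dl dE] : exists dl : R, orlicz_d psi = dl%:E.
  exists (fine (orlicz_d psi)); rewrite fineK// ge0_fin_numE ?orlicz_d_ge0//.
  exact: lt_le_trans db (leey _).
move: db bM; rewrite dE; case: (orlicz_b psi) => [b||]//= db bM.
  rewrite lte_fin in db; move: bM; rewrite tM ?complementary_ge0//.
  move=> /ereal_sup_gt[_ [v /= v0 <-]].
  have := orlicz_ge0 hphi v0; case phiv : (phi v) => [r||]// r0.
  rewrite lee_fin in r0; rewrite -EFinB lte_fin => tbv.
  have dl0 : (0 <= dl)%R by rewrite -lee_fin -dE orlicz_d_ge0.
  have vp : (0 < v)%R.
    by rewrite lt_def v0 andbT; apply: contraTneq tbv => ->; rewrite -leNgt; lra.
  (* The affine minorant with slope v reaches t at (t + r) / v; any point strictly between [s] and b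
     lies beyond both this point and d. *)
  pose s := Num.max dl ((t + r) / v)%R.
  have sb : (s < b)%R by rewrite gt_max db ltr_pdivrMr//; lra.
  have ds : (dl <= s)%R by rewrite le_max lexx.
  have ts : ((t + r) / v <= s)%R by rewrite le_max lexx orbT.
  exists ((s + b) / 2)%R; first by rewrite !lte_fin; apply/andP; split; lra.
  rewrite tM ?complementary_ge0//.
  apply: (@lt_le_trans _ _ (((s + b) / 2) * v - r)%:E).
    rewrite ler_pdivrMr// in ts.
    have := ltr_pM2r vp s b; rewrite sb lte_fin => svbv; lra.
  by apply: ereal_sup_ubound; exists v => //; rewrite phiv EFinB.
have d1 : orlicz_d psi < (dl + 1)%:E by rewrite dE lte_fin; lra.
have [a da ta] := orlicz_d_unbounded t d1.
exists a; first by rewrite ltry andbT lte_fin; lra.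
by rewrite tM ?complementary_ge0.
Qed.

End orlicz_gain.

(** * Choice of signs for a point mass and for a non-atomic measure *)

Section slices_of_small_diameter.
Set Implicit Arguments.
Unset Strict Implicit.
Context d (T : measurableType d) (R : realType).
Variable mu : {sigma_finite_measure set T -> \bar R}.
Variables (phi : R -> \bar R) (hphi : orlicz_function phi).
Local Notation psi := (complementary phi).

(** Integrates the pointwise estimates: applied with factor k to one sign for the point mass, and
    with 2 k to the sum over both signs in the non-atomic case. *)
Lemma integral_le_modular (A : set T) (m k Q : R) (h : {mfun T >-> R})
    (w : T -> \bar R) : measurable A -> mu A = m%:E ->
  (0 <= k)%R -> (0 <= Q)%R -> modular mu psi h <= 1 ->
  measurable_fun setT w -> (forall x, 0 <= w x) ->
  (forall x, w x <= k%:E * psi `|h x|%R + (Q * \1_A x)%:E) ->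
  \int[mu]_x w x <= (k + Q * m)%:E.
Proof.
move=> mA muA k0 Q0 h1 mw w0 wle.
have mh : measurable_fun setT (fun x => psi `|h x|%R).
  exact: measurable_modular_complementary.
have psi0 u := complementary_ge0 hphi u.
have m1 : measurable_fun setT (fun x => (Q * \1_A x)%:E).
  by apply/measurable_EFinP; exact: measurable_funM.
have m2 : measurable_fun setT (fun x => k%:E * psi `|h x|%R).
  exact: measurable_funeM.
apply: (@le_trans _ _ (\int[mu]_x (k%:E * psi `|h x|%R + (Q * \1_A x)%:E))).
  apply: ge0_le_integral => //; exact: emeasurable_funD.
rewrite ge0_integralD//; last 2 first.
- by move=> x _; rewrite mule_ge0.
- by move=> x _; rewrite lee_fin mulr_ge0.
rewrite (integral_scaled_indic mA muA Q0) ge0_integralZl// EFinD leeD2r//.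
by rewrite -[leRHS]mule1; apply: lee_wpmul2l.
Qed.

Lemma unit_point_mass_not_LD2P (x0 : T) (c : R) :
  measurable [set x0] -> mu [set x0] = 1 -> orlicz_d psi < c%:E -> psi c = 1 ->
  ~ local_diameter_two_property (orlicz_space mu hphi).
Proof.
move=> mA muA dc psic; set A := [set x0] in mA muA.
have c0 : (0 < c)%R by rewrite -lte_fin (le_lt_trans (orlicz_d_ge0 hphi)).
have psicoo : psi c < +oo by rewrite psic ltry.
have [p [q [psip psiq /andP[q0 qp]]]] := orlicz_d_midpoint hphi dc psicoo.
have p1 : p = 1%R by apply: EFin_inj; rewrite -psip psic.
rewrite {}p1 in psip qp.
(* With D = 1/2 - q this is 1/2 + D / 4, and the resulting bound for k + psi(k c) is 1 - D (1 - D) /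
   2, which is at most 1. *)
pose k := ((1 + (1 / 2 - q) / 2) / 2)%R.
have k01 : (1 / 2 <= k <= 1)%R by rewrite /k; lra.
have k01' : (0 <= k <= 1)%R by lra.
have := complementary_half_le hphi k01 psip psiq; rewrite mulr1 => psik.
have mg : measurable_fun setT (fun x => c * \1_A x : R)%R by exact: measurable_funM.
pose g : {mfun T >-> R} := HB.pack (fun x => c * \1_A x : R)%R
  (isMeasurableFun.Build _ _ _ _ _ mg).
apply: (slice_small_diameter_not_LD2P (g := g) mA muA (ltW c0) psip (mulr1 _) _ (k := k)) => //.
  by rewrite /k; lra.
move=> h h1.
(* The sign opposite to that of h at the single point of A produces the cancellation. *)
have [s s1 hs] : exists2 s : R, s = 1%R \/ s = (-1)%R &
    forall x, A x -> `|c + s * h x|%R = `|c - `|h x| |%R.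
  have [hx|hx] := leP 0%R (h x0).
    exists (-1)%R; first by right.
    by move=> x ->; rewrite (ger0_norm hx) mulN1r.
  exists 1%R; first by left.
  by move=> x ->; rewrite (ltr0_norm hx) mul1r opprK.
exists s => //.
have Q0 : (0 <= (2 - 2 * k) * q + (2 * k - 1))%R.
  by rewrite -lee_fin (le_trans (complementary_ge0 hphi _) psik).
have measu : measurable_fun setT (fun x => k * (g x + s * h x))%R.
  by apply: measurable_funM => //; apply: measurable_funD => //; exact: measurable_funM.
have k0 : (0 <= k)%R by lra.
apply: le_trans (integral_le_modular mA muA k0 Q0 h1 _ _ _) _.
- exact: measurable_modular_complementary.
- by move=> x; exact: complementary_ge0.
- move=> x; rewrite -[g x]/(c * \1_A x)%R indicE.
  have [/set_mem Ax|_] := boolP (x \in A).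
    rewrite !mulr1 normrM (ger0_norm k0) hs//.
    apply: (le_trans (complementary_dist_le hphi k01' (ltW c0) (normr_ge0 _))).
    by rewrite leeD2l.
  rewrite !mulr0 adde0 add0r normrM (ger0_norm k0) normrM.
  have -> : (`|s| = 1)%R by case: s1 => ->; rewrite ?normrN1 ?normr1.
  by rewrite mul1r; exact: complementary_scale.
rewrite lee_fin /k; have : (0 <= q * (1 / 2 - q))%R by rewrite mulr_ge0//; lra.
nra.
Qed.

(** The sign of h may vary over A, so neither sign need cancel throughout. Instead both modulars are
    added: at each point of A one of the two signs cancels, the sum is at most 2, and so one modular
    is at most 1. *)
Lemma nonatomic_not_LD2P : nonatomic mu -> orlicz_d psi < orlicz_b psi ->
  1 < orlicz_at psi (orlicz_b psi) * mu [set: T] ->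
  ~ local_diameter_two_property (orlicz_space mu hphi).
Proof.
move=> natom db bM.
have [a /andP[da ab] aM] := orlicz_level hphi (M := mu [set: T]) (measure_ge0 _ _) db bM.
have a0 : (0 < a)%R by rewrite -lte_fin (le_lt_trans (orlicz_d_ge0 hphi)).
have [_ [a' [/= a'0 psia'] <-]] := ereal_sup_gt ab.
rewrite lte_fin => aa'.
have psiaoo : psi a < +oo.
  by apply: le_lt_trans psia'; apply: complementary_homo; exact: ltW.
have [p [q0 [psip _ /andP[q00 q0p]]]] := orlicz_d_midpoint hphi da psiaoo.
have p0 : (0 < p)%R by lra.
have [k [b [c [q [k12 kab psib psika gain]]]]] := orlicz_gain hphi da aa' psia' psip.
have pV0 : (0 <= p^-1)%R by rewrite invr_ge0 ltW.
have pT : p^-1%:E < mu [set: T].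
  move: aM; rewrite psip; case: (mu [set: T]) => [r||].
  - by rewrite -EFinM !lte_fin -[(p^-1)%R]mul1r ltr_pdivrMr// mulrC.
  - by rewrite ltry.
  - by rewrite gt0_muleNy ?lte_fin// ltNge leNye.
(* Measure 1 / p makes the modular of a 1_A equal to one. *)
have [A mA muA] := nonatomic_intermediate natom pV0 pT.
have mg : measurable_fun setT (fun x => a * \1_A x : R)%R by exact: measurable_funM.
pose g : {mfun T >-> R} := HB.pack (fun x => a * \1_A x : R)%R
  (isMeasurableFun.Build _ _ _ _ _ mg).
have k2 : (1 / 2 < k)%R by lra.
have pp1 : (p * p^-1 = 1)%R by rewrite divff// gt_eqF.
apply: (slice_small_diameter_not_LD2P (g := g) mA muA (ltW a0) psip pp1 _ k2) => //.
move=> h h1.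
have measu (s : R) : measurable_fun setT (fun x => psi `|k * (g x + s * h x)|%R).
  apply: (measurable_modular_complementary phi (f := fun x => k * (g x + s * h x))%R).
  by apply: measurable_funM => //; apply: measurable_funD => //; exact: measurable_funM.
have psi0 u := complementary_ge0 hphi u.
have c0 : (0 <= c)%R by rewrite -lee_fin -psib.
have qq0 : (0 <= q)%R by rewrite -lee_fin -psika.
have Q0 : (0 <= (1 - k) * c + q)%R by rewrite addr_ge0// mulr_ge0//; lra.
have k0 : (0 <= k)%R by lra.
have kk0 : (0 <= 2 * k)%R by lra.
have k01 : (0 <= k <= 1)%R by lra.
have k01' : (0 <= k < 1)%R by lra.
have sum2 : modular mu psi (fun x => k * (g x + 1 * h x))%R +
            modular mu psi (fun x => k * (g x + -1 * h x))%R <= 2%:E.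
  rewrite /modular -ge0_integralD//.
  apply: le_trans (integral_le_modular mA muA kk0 Q0 h1 _ _ _) _.
  - exact: emeasurable_funD.
  - by move=> x; rewrite adde_ge0.
  - move=> x; rewrite -[g x]/(a * \1_A x)%R indicE.
    have -> : (2 * k)%:E * psi `|h x|%R = k%:E * psi `|h x|%R + k%:E * psi `|h x|%R.
      by rewrite -ge0_muleDl// -EFinD; congr (_%:E * _); lra.
    have [_|_] := boolP (x \in A); last first.
      rewrite !mulr0 adde0 !add0r mul1r mulN1r mulrN normrN normrM (ger0_norm k0).
      by apply: leeD; exact: complementary_scale.
    rewrite !mulr1 mul1r mulN1r.
    (* [near] serves the sign that cancels at x, [far] the other one; the sign of [h x] decides
       which is which. *)
    have near := complementary_dist_le hphi k01 (ltW a0) (normr_ge0 (h x)).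
    have far := complementary_add_le hphi `|h x|%R k01' kab.
    rewrite !normrM (ger0_norm k0).
    rewrite psib -EFinM in far; rewrite psika in near.
    rewrite EFinD addeACA.
    have [hx|hx] := leP 0%R (h x).
      rewrite (ger0_norm hx) in near far *.
      by rewrite (@ger0_norm _ (a + h x)%R) ?leeD// addr_ge0// ltW.
    rewrite (ltr0_norm hx) opprK in near far *.
    rewrite (@ger0_norm _ (a - h x)%R); last by lra.
    by rewrite addeC leeD.
  (* Multiplied by p, the bound 2 k + ((1 - k) c + q) / p <= 2 is exactly [gain]. *)
  rewrite lee_fin -(ler_pM2r p0) mulrDl mulfVK ?gt_eqF//.
  by move: gain; lra.
have [le1|gt1] := leP (modular mu psi (fun x => k * (g x + 1 * h x))%R) 1.
  by exists 1%R => //; left.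
exists (-1)%R; first by right.
rewrite leNgt; apply/negP => gt1'.
have := lteD gt1 gt1'; rewrite -EFinD.
by rewrite ltNge (_ : (1 + 1 = 2 :> R)%R) ?sum2.
Qed.

End slices_of_small_diameter.

(** * Counting measure, and both statements together *)

Lemma counting_not_LD2P (R : realType) (phi : R -> \bar R)
    (hphi : orlicz_function phi) :
  orlicz_d (complementary phi) < orlicz_c (complementary phi) ->
  orlicz_at (complementary phi) (orlicz_c (complementary phi)) = 1 ->
  ~ local_diameter_two_property (orlicz_space (@counting nat R) hphi).
Proof.
set psi := complementary phi => dc.
have d0 : 0 <= orlicz_d psi := orlicz_d_ge0 hphi.
case cE : (orlicz_c psi) (dc) => [c||] dc'.
(* Every singleton has counting measure one; {0} is taken as A, with a = c. *)
- move=> psic; apply: (@unit_point_mass_not_LD2P _ _ _ _ _ _ 0%N c) => //.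
  by rewrite -[LHS]/(counting [set 0%N]) /counting asboolT// fset_set1 finmap.cardfs1.
- (* If psi <= 1 everywhere, then psi = 0 by convexity and d is infinite. *)
  move=> _ _; have [dl dlE] : exists dl : R, orlicz_d psi = dl%:E.
    by exists (fine (orlicz_d psi)); rewrite fineK// ge0_fin_numE.
  have d1 : orlicz_d psi < (dl + 1)%:E by rewrite dlE lte_fin ltrDl.
  have [b _ psib] := orlicz_d_unbounded hphi 1 d1.
  have : b%:E < orlicz_c psi by rewrite cE ltry.
  move=> /ereal_sup_gt[_ [u [/= _ u1] <-]]; rewrite lte_fin => bu.
  have := lt_le_trans psib (complementary_homo phi (ltW bu)).
  by rewrite ltNge u1.
- by move: (le_lt_trans d0 dc').
Qed.

Theorem theorem4p13 (R : realType) (phi : R -> \bar R)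
    (hphi : orlicz_function phi) :
  (forall (d : measure_display) (T : measurableType d)
      (mu : {sigma_finite_measure set T -> \bar R}),
    measure_is_complete mu -> nonatomic mu ->
    orlicz_d (complementary phi) < orlicz_b (complementary phi) ->
    1 < orlicz_at (complementary phi) (orlicz_b (complementary phi)) *
        mu [set: T] ->
    ~ local_diameter_two_property (orlicz_space mu hphi)) /\
  (orlicz_d (complementary phi) < orlicz_c (complementary phi) ->
   orlicz_at (complementary phi) (orlicz_c (complementary phi)) = 1 ->
   ~ local_diameter_two_property (orlicz_space (@counting nat R) hphi)).
Proof.
split=> [d T mu _ natom|]; first exact: nonatomic_not_LD2P.
exact: counting_not_LD2P.
Qed.
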